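(* Let $\mathsf U_i^n\in\mathcal A$ for all $i\in\mathcal V$ and let $\tau>0$. The low-order update defined by $$\mathsf U_i^{L,n+1}:=\Big(1+\frac{2\tau d_{ii}^{L,n}}{m_i}\Big)\Big(\mathsf U_i^n+\frac{\tau}{m_i}\mathsf S_i^{L,n}\Big)+\sum_{j\in\mathcal I(i)\setminus\{i\}}\frac{2\tau d_{ij}^{L,n}}{m_i}\Big(\overline{\mathsf U}_{ij}^n+\frac{\tau}{m_i}\mathsf S_i^{L,n}\Big),\qquad i\in\mathcal V,$$ is algebraically equivalent to $$m_i\frac{\mathsf U_i^{L,n+1}-\mathsf U_i^n}{\tau}=\sum_{j\in\mathcal I(i)}\mathbf F_{ij}^{L,n},$$ $$\mathbf F_{ij}^{L,n}:=-\big(\mathbf g(\mathsf U_j^{n,\ast,i})+\mathbf g(\mathsf U_i^{n,\ast,j})\big)\mathbf c_{ij}+d_{ij}^{L,n}\big(\mathsf U_j^{n,\ast,i}-\mathsf U_i^{n,\ast,j}\big)-\begin{bmatrix}0\\ \tilde c\,\varrho_i^n\vartheta_i^n\big((\varrho_j^{n,\ast,i}\vartheta_j^n)^{\gamma-1}-(\varrho_i^{n,\ast,j}\vartheta_i^n)^{\gamma-1}\big)\mathbf c_{ij}\\0\end{bmatrix}.$$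
   Context: Physical data. $D\subset\mathbb R^d$ is a bounded polygonal domain, $g\ge0$, $\gamma>1$, $C_{\rm eos}>0$, $\tilde c:=C_{\rm eos}\gamma/(\gamma-1)$. For $\mathbf u=(\rho,\mathbf m,\rho\theta)^T\in\mathbb R^{d+2}$: $\mathbf v=\mathbf m/\rho$, $p(\mathbf u)=C_{\rm eos}(\rho\theta)^\gamma$, $\mathcal A=\{\mathbf u:\rho>0,\theta>0\}$, flux $\mathbf f(\mathbf u)=(\mathbf m,\rho^{-1}\mathbf m\otimes\mathbf m+p(\mathbf u)I_d,\mathbf v\rho\theta)^T$, pressureless flux $\mathbf g(\mathbf u)=(\mathbf m,\rho^{-1}\mathbf m\otimes\mathbf m,\mathbf v\rho\theta)^T$. For $\mathbf c\in\mathbb R^d$, $\mathbf g(\mathbf u)\mathbf c=(\mathbf v\cdot\mathbf c)\mathbf u$ and $\mathbf f(\mathbf u)\mathbf c=\mathbf g(\mathbf u)\mathbf c+(0,p(\mathbf u)\mathbf c,0)^T$. Discretization. $\{\varphi_i\}_{i\in\mathcal V}$ is the nodal Lagrange basis (a partition of unity) of the continuous (bi-/tri-)linear finite element space on a mesh of $D$, with nodes $\mathbf x_i$, $z_i:=(\mathbf x_i)_d$; $m_i=\int_D\varphi_i$, $m_{ij}=\int_D\varphi_i\varphi_j$, $\mathbf c_{ij}=\int_D\varphi_i\nabla\varphi_j\,dx$, $\mathcal I(i)=\{j:m_{ij}\neq0\}$. Hence $\sum_{j\in\mathcal I(i)}\mathbf c_{ij}=\mathbf 0$. Nodal states: $\mathsf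 U_i^n=(\varrho_i^n,\mathsf M_i^n,\Theta_i^n)^T$, $\mathsf V_i^n=\mathsf M_i^n/\varrho_i^n$, $\vartheta_i^n=\Theta_i^n/\varrho_i^n$. Star states (for $j\in\mathcal I(i)$, $\bar\vartheta_{ij}=\frac12(\vartheta_i^n+\vartheta_j^n)$): $\varrho_i^{n,\ast,j}=\big((\varrho_i^n)^{\gamma-1}+\frac{g}{\tilde c\,\bar\vartheta_{ij}(\vartheta_i^n)^{\gamma-1}}\max(0,z_i-z_j)\big)^{1/(\gamma-1)}$, $\mathsf U_i^{n,\ast,j}=(\varrho_i^{n,\ast,j},\mathsf V_i^n\varrho_i^{n,\ast,j},\vartheta_i^n\varrho_i^{n,\ast,j})^T$, $p_i^{n,\ast,j}=p(\mathsf U_i^{n,\ast,j})$. Graph viscosity. For $j\in\mathcal I(i)\setminus\{i\}$, $d_{ij}^{L,n}=\max\{\hat\lambda_{\max}(\mathsf U_i^{n,\ast,j},\mathsf U_j^{n,\ast,i})\|\mathbf c_{ij}\|,\ \hat\lambda_{\max}(\mathsf U_j^{n,\ast,i},\mathsf U_i^{n,\ast,j})\|\mathbf c_{ji}\|\}>0$, where $\hat\lambda_{\max}(\mathsf U_L,\mathsf U_R)$ is an upper bound on the maximum wave speed of the Riemann problem for $\partial_t\mathbf u+\partial_x(\mathbf f(\mathbf u)\mathbf n)=0$ with left state $\mathsf U_L$, right state $\mathsf U_R$, and $\mathbf n=\mathbf c_{ij}/\|\mathbf c_{ij}\|$ (resp. $\mathbf c_{ji}/\|\mathbf c_{ji}\|$);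 $d_{ii}^{L,n}:=-\sum_{j\in\mathcal I(i)\setminus\{i\}}d_{ij}^{L,n}$. Bar states ($j\ne i$): $\overline{\mathsf U}_{ij}^n=\frac12(\mathsf U_i^{n,\ast,j}+\mathsf U_j^{n,\ast,i})-\frac1{2d_{ij}^{L,n}}\big(\mathbf f(\mathsf U_j^{n,\ast,i})-\mathbf f(\mathsf U_i^{n,\ast,j})\big)\mathbf c_{ij}$. Affine shift: $\mathsf S_i^{L,n}=\sum_{j\in\mathcal I(i)}\mathsf S_{ij}^{L,n}$ with $$\mathsf S_{ij}^{L,n}=-2(d_{ij}^{L,n}+\mathsf V_i^n\cdot\mathbf c_{ij})(\mathsf U_i^{n,\ast,j}-\mathsf U_i^n)+\begin{bmatrix}0\\(p_j^{n,\ast,i}-p_i^{n,\ast,j})\mathbf c_{ij}-\tilde c\varrho_i^n\vartheta_i^n\big((\varrho_j^{n,\ast,i}\vartheta_j^n)^{\gamma-1}-(\varrho_i^{n,\ast,j}\vartheta_i^n)^{\gamma-1}\big)\mathbf c_{ij}\\0\end{bmatrix}.$$ *)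

(* Defs.v *)
From HB Require Import structures.
From mathcomp Require Import all_boot all_order all_algebra.
From mathcomp Require Import all_classical all_reals all_analysis.

Set Implicit Arguments.
Unset Strict Implicit.
Unset Printing Implicit Defensive.

Import Order.TTheory GRing.Theory Num.Theory.
Import numFieldNormedType.Exports.

Local Open Scope classical_set_scope.
Local Open Scope ring_scope.

Definition dotp {R : realType} {d : nat} (x y : 'cV[R]_d) : R :=
  \sum_k x k 0 * y k 0.

(* Euclidean norm; the library norm on matrices is the sup norm. *)
Definition enorm {R : realType} {d : nat} (x : 'cV[R]_d) : R :=
  Num.sqrt (dotp x x).


Definition state (R : realType) (d : nat) : Type := 'cV[R]_(1 + d + 1).

Definition mkstate {R : realType} {d : nat} (r : R) (m : 'cV[R]_d) (q : R) :
  state R d := col_mx (col_mx r%:M m) q%:M.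

Section StateComponents.
Context {R : realType} {d : nat}.
Implicit Type u : state R d.

Definition rho u : R := usubmx (usubmx u) 0 0.
Definition mom u : 'cV[R]_d := dsubmx (usubmx u).
Definition rhotheta u : R := dsubmx u 0 0.
Definition vel u : 'cV[R]_d := (rho u)^-1 *: mom u.
Definition theta u : R := rhotheta u / rho u.
Definition admissible u : Prop := 0 < rho u /\ 0 < theta u.
End StateComponents.

Record physics (R : realType) := Physics {
  grav : R;
  gam : R;
  Ceos : R }.

Definition ctilde {R : realType} (P : physics R) : R :=
  Ceos P * gam P / (gam P - 1).

Section Fluxes.
Context {R : realType} {d : nat}.
Variable P : physics R.
Implicit Type u : state R d.

Definition pressure u : R := Ceos P * rhotheta u `^ gam P.

Definition flux u : 'M[R]_(1 + d + 1, d) :=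
  col_mx (col_mx (mom u)^T
                 ((rho u)^-1 *: (mom u *m (mom u)^T) + (pressure u)%:M))
         (rhotheta u *: (vel u)^T).

Definition flux0 u : 'M[R]_(1 + d + 1, d) :=
  col_mx (col_mx (mom u)^T ((rho u)^-1 *: (mom u *m (mom u)^T)))
         (rhotheta u *: (vel u)^T).


(* Mechanical energy and its flux: an entropy pair of the system
   d_t u + div f(u) = 0, since p = C_eos (rho theta)^gamma. *)
Definition energy u : R :=
  (2 * rho u)^-1 * dotp (mom u) (mom u)
  + Ceos P / (gam P - 1) * rhotheta u `^ gam P.

Definition energy_flux u : 'cV[R]_d := (energy u + pressure u) *: vel u.

(* The self-similar function u(x, t) = w (x / t) solves
     d_t u + d_x (f(u) n) = 0,   u(x, 0) = UL (x < 0), UR (x > 0).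
   Away from the finitely many speeds in S it is a classical solution; at
   a speed in S it has one-sided limits satisfying the Rankine-Hugoniot
   conditions and the entropy inequality. The Riemann solution for data in
   the admissible set may contain vacuum, encoded by the state 0 (at which
   rho^-1 = 0, so the velocity, the flux and the energy vanish). *)
Definition riemann_solution (n : 'cV[R]_d) (UL UR : state R d)
    (w : R -> state R d) : Prop :=
  [/\ forall xi, admissible (w xi) \/ w xi = 0,
      w xi @[xi --> -oo] --> UL,
      w xi @[xi --> +oo] --> UR
    & exists S : seq R,
      (forall xi, xi \notin S ->
         [/\ derivable w xi 1,
             derivable (fun x => flux (w x) *m n) xi 1
           & 'D_1 (fun x => flux (w x) *m n) xi = xi *: 'D_1 w xi]) /\
      (forall s, s \in S -> exists wl wr : state R d,
         [/\ w x @[x --> s^'-] --> wl,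
             w x @[x --> s^'+] --> wr,
             w s = wl \/ w s = wr,
             (admissible wl \/ wl = 0) /\ (admissible wr \/ wr = 0)
           & (flux wr - flux wl) *m n = s *: (wr - wl) /\
             dotp (energy_flux wr - energy_flux wl) n
               <= s * (energy wr - energy wl)])].

Definition max_wave_speed_le (n : 'cV[R]_d) (UL UR : state R d) (lam : R) :
    Prop :=
  forall w, riemann_solution n UL UR w ->
    (forall xi, xi < - lam -> w xi = UL) /\ (forall xi, lam < xi -> w xi = UR).

Definition max_wave_speed_bound
    (lam : 'cV[R]_d -> state R d -> state R d -> R) : Prop :=
  forall n UL UR, enorm n = 1 -> admissible UL -> admissible UR ->
    max_wave_speed_le n UL UR (lam n UL UR).
End Fluxes.


Definition borel (R : realType) (d : nat) :=
  g_sigma_algebraType (@open 'cV[R]_d).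

(* These values on boxes determine a Borel measure uniquely. *)
Definition is_lebesgue (R : realType) (d : nat)
    (mu : {measure set (borel R d) -> \bar R}) : Prop :=
  forall a b : 'cV[R]_d, (forall k, a k 0 <= b k 0) ->
    mu [set x : 'cV[R]_d | forall k, a k 0 <= x k 0 <= b k 0] =
    (\prod_k (b k 0 - a k 0))%:E.

(* The closure is a finite union of polyhedra, each a finite intersection of
   half-spaces h.1 . x <= h.2. *)
Definition polygonal_domain (R : realType) (d : nat) (D : set 'cV[R]_d) :
    Prop :=
  [/\ open D, connected D, D !=set0, bounded_set D
    & exists ss : seq (seq ('cV[R]_d * R)),
        closure D = [set x | exists2 s, s \in ss &
                             forall h, h \in s -> dotp h.1 x <= h.2]].

Variant cell_kind := Simplex | Cube.

Definition ref_vertex (k : cell_kind) (d : nat) : finType :=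
  match k with
  | Simplex => 'I_d.+1
  | Cube => {ffun 'I_d -> bool}
  end.

Definition ref_cell (R : realType) (k : cell_kind) (d : nat) :
    set 'cV[R]_d :=
  match k with
  | Simplex => [set x | (forall l, 0 <= x l 0) /\ \sum_l x l 0 <= 1]
  | Cube => [set x | forall l, 0 <= x l 0 <= 1]
  end.

(* Barycentric coordinates (vertex 0 is the origin, vertex l + 1 the l-th unit
   vector), resp. tensor products of the one-dimensional hat functions. *)
Definition ref_shape (R : realType) (k : cell_kind) (d : nat) :
    ref_vertex k d -> 'cV[R]_d -> R :=
  match k with
  | Simplex => fun v x =>
      if unlift ord0 v is Some l then x l 0 else 1 - \sum_l x l 0
  | Cube => fun v x => \prod_l (if v l then x l 0 else 1 - x l 0)
  end.

Section Mesh.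
Context {R : realType} {d : nat} {V C : finType}.
Variables (k : cell_kind) (node : V -> 'cV[R]_d).
Variable vert : C -> ref_vertex k d -> V.

Definition cell_map (K : C) (x : 'cV[R]_d) : 'cV[R]_d :=
  \sum_v ref_shape v x *: node (vert K v).

Definition cell (K : C) : set 'cV[R]_d := cell_map K @` @ref_cell R k d.

(* Nondegeneracy of a cell: its (multi)linear cell map has a Lipschitz inverse,
   and its boundary is null (as any Lipschitz boundary is). The conformity of the mesh
   is not repeated here: it is what makes a continuous nodal basis (see
   [nodal_basis]) exist. *)
Definition is_mesh (mu : {measure set (borel R d) -> \bar R})
    (D : set 'cV[R]_d) : Prop :=
  [/\ injective node,
      forall i, exists K v, vert K v = i,
      closure D = \bigcup_(K in [set: C]) cell K,
      forall K K', K != K' -> (cell K)° `&` (cell K')° = set0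
    & forall K,
      (exists L : R, forall x y, ref_cell k x -> ref_cell k y ->
         enorm (x - y) <= L * enorm (cell_map K x - cell_map K y)) /\
      mu (cell K `\` (cell K)°) = 0%E].

Definition fe_space (D : set 'cV[R]_d) (f : 'cV[R]_d -> R) : Prop :=
  {within closure D, continuous f} /\
  forall K, exists a : ref_vertex k d -> R,
    forall x, ref_cell k x -> f (cell_map K x) = \sum_v a v * ref_shape v x.

Definition nodal_basis (D : set 'cV[R]_d) (phi : V -> 'cV[R]_d -> R) : Prop :=
  forall i, fe_space D (phi i) /\ forall j, phi i (node j) = (i == j)%:R.
End Mesh.

Record discretization (R : realType) (d : nat) (V : finType) := Discretization {
  leb : {measure set (borel R d) -> \bar R};
  dom : set 'cV[R]_d;
  node : V -> 'cV[R]_d;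
  phi : V -> 'cV[R]_d -> R }.

Definition lagrange_discretization (R : realType) (d : nat) (V : finType)
    (h : discretization R d V) : Prop :=
  [/\ is_lebesgue (leb h), polygonal_domain (dom h)
    & exists (k : cell_kind) (C : finType) (vert : C -> ref_vertex k d -> V),
        is_mesh (node h) vert (leb h) (dom h) /\
        nodal_basis (node h) vert (dom h) (phi h)].

Section Assembly.
Context {R : realType} {d : nat} {V : finType}.
Variable h : discretization R d V.

Definition mass (i : V) : R := Rintegral (leb h) (dom h) (phi h i).

Definition mass2 (i j : V) : R :=
  Rintegral (leb h) (dom h) (fun x => phi h i x * phi h j x).

Definition cvec (i j : V) : 'cV[R]_d :=
  \col_l Rintegral (leb h) (dom h)
           (fun x => phi h i x * 'D_(delta_mx l 0) (phi h j) x).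

Definition stencil (i : V) : pred V := fun j => mass2 i j != 0.
End Assembly.


(* The space dimension is d.+1; the height z is the last coordinate. *)
Section LowOrder.
Context {R : realType} {d : nat} {V : finType}.
Variables (P : physics R) (h : discretization R d.+1 V).
Variable lam : 'cV[R]_d.+1 -> state R d.+1 -> state R d.+1 -> R.
Variable U : V -> state R d.+1.
Implicit Types i j : V.

Definition height i : R := node h i ord_max 0.

Definition theta_bar i j : R := (theta (U i) + theta (U j)) / 2.

Definition rho_star i j : R :=
  (rho (U i) `^ (gam P - 1)
   + grav P / (ctilde P * theta_bar i j * theta (U i) `^ (gam P - 1))
     * Num.max 0 (height i - height j)) `^ (1 / (gam P - 1)).

(* [star i j] is U_i^{*,j}. *)
Definition star i j : state R d.+1 :=
  mkstate (rho_star i j) (rho_star i j *: vel (U i))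
          (theta (U i) * rho_star i j).

Definition wave_visc i j : R :=
  lam ((enorm (cvec h i j))^-1 *: cvec h i j) (star i j) (star j i)
  * enorm (cvec h i j).

Definition visc i j : R :=
  if j == i then
    - \sum_(l | stencil h i l && (l != i)) Num.max (wave_visc i l) (wave_visc l i)
  else Num.max (wave_visc i j) (wave_visc j i).

Definition bar i j : state R d.+1 :=
  2^-1 *: (star i j + star j i)
  - (2 * visc i j)^-1 *: ((flux P (star j i) - flux P (star i j)) *m cvec h i j).

Definition wb_diff i j : R :=
  (rho_star j i * theta (U j)) `^ (gam P - 1)
  - (rho_star i j * theta (U i)) `^ (gam P - 1).

Definition shift_ij i j : state R d.+1 :=
  - ((2 * (visc i j + dotp (vel (U i)) (cvec h i j))) *: (star i j - U i))
  + mkstate 0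
      ((pressure P (star j i) - pressure P (star i j)) *: cvec h i j
       - (ctilde P * rho (U i) * theta (U i) * wb_diff i j) *: cvec h i j)
      0.

Definition shift i : state R d.+1 := \sum_(j | stencil h i j) shift_ij i j.

Definition low_update (tau : R) i : state R d.+1 :=
  (1 + 2 * tau * visc i i / mass h i) *: (U i + (tau / mass h i) *: shift i)
  + \sum_(j | stencil h i j && (j != i))
      (2 * tau * visc i j / mass h i) *: (bar i j + (tau / mass h i) *: shift i).

Definition low_flux i j : state R d.+1 :=
  - ((flux0 (star j i) + flux0 (star i j)) *m cvec h i j)
  + visc i j *: (star j i - star i j)
  - mkstate 0
      ((ctilde P * rho (U i) * theta (U i) * wb_diff i j) *: cvec h i j) 0.
End LowOrder.

(* Main.v *)
Require Import Defs.
From mathcomp Require Import all_boot all_order all_algebra.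
From mathcomp Require Import all_classical all_reals all_analysis.
From mathcomp Require Import measurable_realfun ring lra.

(* Since f(u)c = g(u)c + (0, p(u)c, 0) and g(U_i^{*,j})c = (V_i . c) U_i^{*,j},
   the contribution of j to S_i + sum_j 2 d_ij (bar U_ij - U_i) is
   F_ij + 2 (V_i . c_ij) U_i, so the two forms of the update agree as soon as
   m_i <> 0 and sum_{j in I(i)} c_ij = 0.

   The second identity is the derivative of the partition of unity, integrated
   against phi_i. The cell maps and the shape functions admit factorisations
   F(y) - F(x) = A(x, y)(y - x) with A continuous (Caratheodory's form of
   differentiability), and A(x, x) is invertible because the cell maps have
   Lipschitz inverses; hence the nodal functions have bounded directional
   derivatives inside the cells, that is, almost everywhere. Finally c_ij = 0
   when m_ij = 0: the nodal functions are nonnegative, so that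
   phi_i phi_j = 0 on D and phi_j vanishes near every point where phi_i does
   not. *)

Set Implicit Arguments.
Unset Strict Implicit.
Unset Printing Implicit Defensive.

Import Order.TTheory GRing.Theory Num.Theory.
Import numFieldNormedType.Exports.

Local Open Scope classical_set_scope.
Local Open Scope ring_scope.

(** * Algebra of the low-order update *)

Section StateAlgebra.
Context {R : realType} {d : nat}.
Implicit Types (u : state R d) (c : 'cV[R]_d).

Lemma mkstate0E m : mkstate 0 m 0 = col_mx (col_mx 0 m) 0 :> state R d.
Proof. by rewrite /mkstate !raddf0. Qed.

Lemma mkstateB (m1 m2 : 'cV[R]_d) :
  mkstate 0 (m1 - m2) 0 = mkstate 0 m1 0 - mkstate 0 m2 0 :> state R d.
Proof.
by rewrite !mkstate0E !opp_col_mx !add_col_mx !subr0.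
Qed.

Lemma mkstateK u : mkstate (rho u) (mom u) (rhotheta u) = u.
Proof. by rewrite /mkstate -!mx11_scalar !vsubmxK. Qed.

Lemma rho_mkstate r m q : rho (mkstate r m q : state R d) = r.
Proof. by rewrite /rho /mkstate !col_mxKu mxE eqxx mulr1n. Qed.

Lemma mom_mkstate r m q : mom (mkstate r m q : state R d) = m.
Proof. by rewrite /mom /mkstate col_mxKu col_mxKd. Qed.

Lemma rhotheta_mkstate r m q : rhotheta (mkstate r m q : state R d) = q.
Proof. by rewrite /rhotheta /mkstate col_mxKd mxE eqxx mulr1n. Qed.

Lemma dotpE (x y : 'cV[R]_d) : x^T *m y = (dotp x y)%:M.
Proof.
rewrite [LHS]mx11_scalar; congr (_%:M).
by rewrite mxE; apply: eq_bigr => k _; rewrite mxE.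
Qed.

Lemma dotpZl a (x y : 'cV[R]_d) : dotp (a *: x) y = a * dotp x y.
Proof.
by rewrite /dotp mulr_sumr; apply: eq_bigr => k _; rewrite mxE mulrA.
Qed.

Lemma dotp0r (x : 'cV[R]_d) : dotp x 0 = 0.
Proof. by rewrite /dotp big1 // => k _; rewrite mxE mulr0. Qed.

Lemma dotp_sumr (I : finType) (Q : pred I) (x : 'cV[R]_d) (y : I -> 'cV[R]_d) :
  dotp x (\sum_(i | Q i) y i) = \sum_(i | Q i) dotp x (y i).
Proof.
rewrite /dotp exchange_big; apply: eq_bigr => k _.
by rewrite summxE mulr_sumr.
Qed.

Lemma flux_flux0 P u c :
  flux P u *m c = flux0 u *m c + mkstate 0 (pressure P u *: c) 0.
Proof.
rewrite /flux /flux0 mkstate0E !mul_col_mx !add_col_mx mulmxDl mul_scalar_mx.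
by rewrite !addr0.
Qed.

Lemma flux0_mkstate r v t c :
  flux0 (mkstate r (r *: v) (t * r) : state R d) *m c
  = dotp v c *: (mkstate r (r *: v) (t * r) : state R d).
Proof.
rewrite /flux0 /vel rho_mkstate mom_mkstate rhotheta_mkstate.
rewrite !mul_col_mx /mkstate !scale_col_mx linearZ /= -!scalemxAl -!scalemxAr.
rewrite -!scalemxAl -!mulmxA !dotpE.
(* For [r = 0] every block vanishes; otherwise [r] cancels against the inverse density. *)
have [->|r0] := eqVneq r 0; first by rewrite ?(scale0r, mulr0, scaler0, raddf0).
rewrite !dotpZl !mul_mx_scalar !scale_scalar_mx !scalerA.
congr (col_mx (col_mx _%:M (_ *: v)) _%:M); first by rewrite mulrC.
  by field.
by field.
Qed.

End StateAlgebra.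

(** The weights of the two terms add up to 1, so the common shift [S] enters exactly once and
    subtracting [u] leaves only the differences [b j - u]. Here [w] stands for the off-diagonal
    viscosities, whose negated sum is the diagonal one. *)
Lemma update_convex_form (R : fieldType) (E : lmodType R) (I : finType) (Q : pred I)
    (t m : R) (w : I -> R) (b : I -> E) (u S : E) :
  (1 + 2 * t * (- \sum_(j | Q j) w j) / m) *: (u + (t / m) *: S)
    + \sum_(j | Q j) (2 * t * w j / m) *: (b j + (t / m) *: S) - u
  = (t / m) *: (S + \sum_(j | Q j) (2 * w j) *: (b j - u)).
Proof.
have -> : \sum_(j | Q j) (2 * t * w j / m) *: (b j + (t / m) *: S) =
    (t / m) *: (\sum_(j | Q j) (2 * w j) *: (b j - u))
    + ((t / m) * (2 * \sum_(j | Q j) w j)) *: (u + (t / m) *: S).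
  rewrite scaler_sumr mulr_sumr mulr_sumr scaler_suml -big_split /=.
  apply: eq_bigr => j _; rewrite scalerA.
  have -> : 2 * t * w j / m = t / m * (2 * w j) by ring.
  by rewrite -scalerDr addrA subrK.
have -> : 1 + 2 * t * (- \sum_(j | Q j) w j) / m
    = 1 - t / m * (2 * \sum_(j | Q j) w j) by ring.
rewrite scalerBl scale1r [in RHS]scalerDr.
rewrite [_ *: \sum_(_ | _) _ + _]addrC addrA subrK.
by rewrite addrAC (addrAC u) subrr add0r.
Qed.

(** * Equivalence of the two forms of the update *)

Section LowOrderAlgebra.
Context {R : realType} {d : nat} {V : finType}.
Variables (P : physics R) (h : discretization R d.+1 V).
Variables (lam : 'cV[R]_d.+1 -> state R d.+1 -> state R d.+1 -> R).
Variables (U : V -> state R d.+1) (tau : R).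
Hypotheses (gam1 : 1 < gam P) (admU : forall i, admissible (U i)).

Lemma rho_star_diag i : rho_star P h U i i = rho (U i).
Proof.
have g0 : gam P - 1 != 0 by rewrite subr_eq0 gt_eqF.
rewrite /rho_star subrr maxxx mulr0 addr0 -powRrM mulrC -mulrA mulVf //.
by rewrite mulr1 powRr1 // ltW //; have [] := admU i.
Qed.

Lemma star_diag i : star P h U i i = U i.
Proof.
have [/gt_eqF/negbT r0 _] := admU i.
rewrite /star rho_star_diag /vel /theta scalerA divff // scale1r divfK //.
exact: mkstateK.
Qed.

Lemma flux0_star i j c :
  flux0 (star P h U i j) *m c = dotp (vel (U i)) c *: star P h U i j.
Proof. exact: flux0_mkstate. Qed.

Lemma shift_ii i : shift_ij P h lam U i i = 0.
Proof.
rewrite /shift_ij /wb_diff star_diag !subrr scaler0 oppr0 add0r mulr0 !scale0r.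
by rewrite subrr mkstate0E !col_mx0.
Qed.

(** This is the negative of the remainder [2 (V_i . c_ii) U_i], so the term [j = i] can be added to
    the sum over the neighbours at no cost. *)
Lemma low_flux_diag i :
  low_flux P h lam U i i = - (2 * dotp (vel (U i)) (cvec h i i)) *: U i.
Proof.
rewrite /low_flux /wb_diff !subrr mulr0 scale0r scaler0 addr0 mulmxDl.
rewrite flux0_star star_diag mkstate0E !col_mx0 subr0.
by rewrite -mulr2n -scaler_nat scalerA scaleNr.
Qed.

(** The pressure jump in the shift cancels the one in the bar state, which leaves [flux0]. With
    [a = V_i . c_ij], the flux of [star i j] is [a *: star i j], and the term [- 2 a] times
    [star i j] of the shift turns the difference of the two fluxes into minus their sum. *)
Lemma shift_ij_bar i j : visc P h lam U i j != 0 ->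
  shift_ij P h lam U i j
    + (2 * visc P h lam U i j) *: (bar P h lam U i j - U i)
  = low_flux P h lam U i j
    + (2 * dotp (vel (U i)) (cvec h i j)) *: U i.
Proof.
move=> d0; rewrite /shift_ij /bar /low_flux mulmxBl [in RHS]mulmxDl.
move: (flux0_star i j (cvec h i j)) d0.
move: (star P h U i j) (star P h U j i) (cvec h i j) (visc P h lam U i j)
  (dotp (vel (U i)) (cvec h i j)) => A B c nu a fA nu0.
rewrite !flux_flux0 fA mkstateB scalerBl mkstateB.
move: (mkstate 0 _ 0) (mkstate 0 _ 0) (mkstate 0 _ 0) (_ *m _) => W1 W2 W3 G.
by apply/matrixP => k l; rewrite !mxE; field.
Qed.

Lemma low_update_flux_form i (Unew : state R d.+1) :
  tau != 0 -> mass h i != 0 -> \sum_(j | stencil h i j) cvec h i j = 0 ->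
  (forall j, stencil h i j -> j != i -> visc P h lam U i j != 0) ->
  Unew = low_update P h lam U tau i <->
  mass h i *: (tau^-1 *: (Unew - U i)) =
    \sum_(j | stencil h i j) low_flux P h lam U i j.
Proof.
move=> tau0 m0 c0 d0.
(* Scaling by [mass h i / tau] is injective, so it is enough to evaluate the right-hand form at the
   low-order update itself. *)
suff <- : mass h i *: (tau^-1 *: (low_update P h lam U tau i - U i))
    = \sum_(j | stencil h i j) low_flux P h lam U i j.
  split=> [->//|/(scalerI m0)].
  by move/(scalerI (invr_neq0 tau0))/addIr.
have -> : low_update P h lam U tau i - U i = (tau / mass h i) *:
    (Defs.shift P h lam U i + \sum_(j | stencil h i j && (j != i))
       (2 * visc P h lam U i j) *: (bar P h lam U i j - U i)).
  rewrite -update_convex_form /low_update; congr ((1 + 2 * tau * _ / _) *: _ + _ - _).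
  rewrite {1}/visc eqxx; congr (- _).
  by apply: eq_bigr => j /andP[_ ji]; rewrite /visc (negbTE ji).
rewrite !scalerA (_ : mass h i / tau * (tau / mass h i) = 1) ?scale1r; last first.
  by field; rewrite tau0 m0.
have -> : Defs.shift P h lam U i =
    \sum_(j | stencil h i j && (j != i)) shift_ij P h lam U i j.
  rewrite /Defs.shift; have [si|si] := boolP (stencil h i i).
    by rewrite (bigD1 i) //= shift_ii add0r.
  apply: eq_bigl => j; have [->|] := eqVneq j i; last by rewrite andbT.
  by rewrite (negbTE si).
rewrite -big_split /=.
(* The remainder in [F j] is linear in [c_ij]; once the diagonal term is restored, it sums to zero
   over the stencil. *)
pose F j := low_flux P h lam U i j
  + (2 * dotp (vel (U i)) (cvec h i j)) *: U i.
rewrite (eq_bigr F); last by move=> j /andP[sj ji]; apply/shift_ij_bar/d0.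
have Fi : F i = 0 by rewrite /F low_flux_diag scaleNr addNr.
have -> : \sum_(j | stencil h i j && (j != i)) F j = \sum_(j | stencil h i j) F j.
  have [si|si] := boolP (stencil h i i).
    by rewrite [RHS](bigD1 i) //= Fi add0r.
  apply: eq_bigl => j; have [->|] := eqVneq j i; last by rewrite andbT.
  by rewrite (negbTE si).
rewrite big_split /= -scaler_suml -mulr_sumr -dotp_sumr c0.
by rewrite dotp0r mulr0 scale0r addr0.
Qed.

End LowOrderAlgebra.

(** * Charts with a Lipschitz inverse *)

Section EuclideanNorm.
Context {R : realType} {n : nat}.
Implicit Types x y : 'cV[R]_n.

Lemma enormZ a x : enorm (a *: x) = `|a| * enorm x.
Proof.
rewrite /enorm (_ : dotp _ _ = a ^+ 2 * dotp x x).
  by rewrite sqrtrM ?sqr_ge0 // sqrtr_sqr.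
by rewrite /dotp mulr_sumr; apply: eq_bigr => k _; rewrite !mxE; ring.
Qed.

Lemma ler_coord_enorm x k : `|x k 0| <= enorm x.
Proof.
rewrite -sqrtr_sqr /enorm; apply: ler_wsqrtr; rewrite /dotp (bigD1 k) //=.
by rewrite -expr2 lerDl; apply: sumr_ge0 => l _; rewrite -expr2 sqr_ge0.
Qed.

Lemma enorm0_eq0 x : enorm x <= 0 -> x = 0.
Proof.
move=> x0; apply/colP => k; rewrite mxE; apply/eqP.
by rewrite -normr_le0 (le_trans (ler_coord_enorm x k)).
Qed.

Lemma enorm0 : enorm (0 : 'cV[R]_n) = 0.
Proof. by rewrite -(scale0r (0 : 'cV[R]_n)) enormZ normr0 mul0r. Qed.

Lemma cvg_enorm (T : Type) (F : set_system T) (FF : Filter F)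
    (u : T -> 'cV[R]_n) x :
  (forall k, u t k 0 @[t --> F] --> x k 0) -> enorm (u t) @[t --> F] --> enorm x.
Proof.
move=> ux; have dx : dotp (u t) (u t) @[t --> F] --> dotp x x; last first.
  exact: (cvg_comp _ _ dx (@sqrt_continuous R (dotp x x))).
apply: cvg_big; first exact: add_continuous.
by move=> k _; apply: cvgM.
Qed.

End EuclideanNorm.

Section Charts.
Context {R : realType} {n : nat}.
Implicit Types (x y z e : 'cV[R]_n) (f : 'cV[R]_n -> R) (F : 'cV[R]_n -> 'cV[R]_n).

(* With [q := (z - x) / t] where [F z = F x + t e], one has [A z *m q = e] and
   the difference quotient of f is [r z *m q], so that its distance to
   [r x *m invmx (A x) *m e] is bounded by [rho z *m q], where [rho] is
   continuous and vanishes at x, and q is bounded. *)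
Lemma derivable_chart f F (T : set 'cV[R]_n) x e (L M : R)
    (A : 'cV[R]_n -> 'M[R]_n) (r : 'cV[R]_n -> 'rV[R]_n) :
  nbhs (F x) (F @` T) ->
  (forall z, T z -> F z - F x = A z *m (z - x)) ->
  (forall z, T z -> f (F z) - f (F x) = (r z *m (z - x)) 0 0) ->
  (forall z, T z -> enorm (z - x) <= L * enorm (F z - F x)) ->
  (forall i j, A z i j @[z --> x] --> A x i j) ->
  (forall j, r z 0 j @[z --> x] --> r x 0 j) ->
  (forall z j, T z -> `|r z 0 j| <= M) ->
  A x \in unitmx ->
  derivable f (F x) e /\ `|'D_e f (F x)| <= n%:R * (M * (L * enorm e)).
Proof.
move=> nFT FA fr FL Ac rc rM Au.
pose rho z := r z - r x *m invmx (A x) *m A z.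
pose sigma z := \sum_j `|rho z 0 j| * (L * enorm e).
pose l := (r x *m invmx (A x) *m e) 0 0.
have sigma_cvg : sigma z @[z --> x] --> 0.
  move: (nbhs x) (nbhs_filter x : Filter (nbhs x)) Ac rc => G FG Ac rc.
  have -> : 0 = \sum_(j < n) `|0 : R| * (L * enorm e).
    by rewrite big1 // => j _; rewrite normr0 mul0r.
  apply: cvg_big; first exact: add_continuous.
  move=> j _; apply: cvgM; last exact: cvg_cst.
  apply: cvg_norm.
  have -> : 0 = r x 0 j - \sum_k (r x *m invmx (A x)) 0 k * A x k j.
    transitivity (r x 0 j - (r x *m invmx (A x) *m A x) 0 j).
      by rewrite mulmxKV // subrr.
    by rewrite [X in _ - X]mxE.
  under eq_fun => z do rewrite /rho !mxE.
  apply: cvgB; first exact: rc.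
  apply: cvg_big; first exact: add_continuous.
  by move=> k _; apply: cvgM; [exact: cvg_cst|exact: Ac].
have quot h : h != 0 -> (F @` T) (h *: e + F x) ->
  exists2 z, T z /\ enorm (z - x) <= L * (`|h| * enorm e) &
  exists q : 'cV[R]_n, [/\ forall j, `|q j 0| <= L * enorm e,
    h^-1 *: (f (h *: e + F x) - f (F x)) = (r z *m q) 0 0 & e = A z *m q].
  move=> h0 [z Tz Fz]; exists z.
    by split=> //; apply: le_trans (FL z Tz) _; rewrite Fz addrK enormZ.
  exists (h^-1 *: (z - x)); split.
  - move=> j; apply: le_trans (ler_coord_enorm _ _) _; rewrite enormZ normfV.
    rewrite ler_pdivrMl ?normr_gt0 // mulrCA.
    by apply: le_trans (FL z Tz) _; rewrite Fz addrK enormZ.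
  - by rewrite -Fz fr // linearZ /= [in RHS]mxE.
  - by rewrite -scalemxAr -FA // Fz addrK scalerA mulVf // scale1r.
have near_quot : \forall h \near 0^', h != 0 /\ (F @` T) (h *: e + F x).
  near=> h; split; first by near: h; exact: nbhs_dnbhs_neq.
  near: h; apply: cvg_within.
  have : (h *: e + F x) @[h --> (0 : R)] --> F x.
    rewrite -[X in _ --> X]add0r -(scale0r e).
    by apply: cvgD; [apply: cvgZr_tmp; exact: cvg_id|exact: cvg_cst].
  by apply.
have lE z q : e = A z *m q -> (r z *m q) 0 0 - l = (rho z *m q) 0 0.
  move=> eA; rewrite /l [in X in _ - X]eA /rho mulmxBl !mulmxA [RHS]mxE.
  by congr (_ + _); rewrite [RHS]mxE.
have Lcvg : L * (`|h| * enorm e) @[h --> (0 : R)^'] --> (0 : R).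
  apply: cvg_within_filter.
  have : L * (`|h| * enorm e) @[h --> (0 : R)] --> L * (`|0 : R| * enorm e).
    apply: cvgM; first exact: cvg_cst.
    by apply: cvgM; [exact: cvg_norm|exact: cvg_cst].
  by rewrite normr0 mul0r mulr0.
have Qcvg : h^-1 *: (f (h *: e + F x) - f (F x)) @[h --> 0^'] --> l.
  apply/cvgrPdist_le => eps eps0.
  (* [sigma] is at most [eps] on the ball of radius [d]; for small [h] the Lipschitz bound
     [L |h| enorm e] puts [z] in that ball. *)
  have [d /= d0 dsig] : nbhs_ball x [set z | sigma z <= eps].
    apply/nbhs_ballP; move/cvgr0_norm_le : sigma_cvg => /(_ _ eps0).
    by apply: filterS => z; apply: le_trans; rewrite ler_norm.
  near=> h.
  have [h0 Fh] : h != 0 /\ (F @` T) (h *: e + F x) by near: h.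
  have [z [Tz xz] [q [qL -> eA]]] := quot h h0 Fh.
  rewrite distrC lE //; apply: le_trans (dsig z _); last first.
    split=> // i j; rewrite ord1 /ball /= distrC.
    have -> : z i 0 - x i 0 = (z - x) i 0 by rewrite !mxE.
    apply: le_lt_trans (ler_coord_enorm _ _) _; apply: le_lt_trans xz _.
    by near: h; apply: (cvgr_lt (0 : R)).
  rewrite mxE; apply: le_trans (ler_norm_sum _ _ _) _.
  by apply: ler_sum => j _; rewrite normrM ler_wpM2l.
split; first by apply/cvg_ex; exists l.
rewrite /derive (cvg_lim _ Qcvg) //.
(* The bound holds for every small difference quotient [r z *m q] and passes to the limit. *)
have : `|h^-1 *: (f (h *: e + F x) - f (F x))| @[h --> 0^'] --> `|l|.
  exact: cvg_norm.
move/cvgr_to_le; apply.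
near=> h.
have [h0 Fh] : h != 0 /\ (F @` T) (h *: e + F x) by near: h.
have [z [Tz xz] [q [qL -> eA]]] := quot h h0 Fh.
rewrite mxE; apply: le_trans (ler_norm_sum _ _ _) _.
apply: (@le_trans _ _ (\sum_(j < n) (M * (L * enorm e)))).
  by apply: ler_sum => j _; rewrite normrM ler_pM // rM.
by rewrite sumr_const card_ord mulr_natl.
Unshelve. all: by end_near. Qed.

End Charts.

(** * Reference cells *)

Lemma cvg_mx (R : realType) (m n : nat) (T : Type) (F : set_system T)
    (FF : Filter F) (u : T -> 'M[R]_(m, n)) (x : 'M[R]_(m, n)) :
  (forall i j, u t i j @[t --> F] --> x i j) -> u t @[t --> F] --> x.
Proof.
move=> ux A [P xP sPA]; suff : \forall t \near F, forall i j, P i j (u t i j).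
  by apply: filterS => t Pt; exact: sPA.
by apply: filter_forall => i; apply: filter_forall => j; exact/ux/xP.
Qed.

(** The factors of one product are replaced by those of the other, one at a time. This writes the
    increment of a tensor-product shape function as a combination of the coordinate increments. *)
Lemma prodrB_telescope (R : comPzRingType) (n : nat) (a b : 'I_n -> R) :
  \prod_l a l - \prod_l b l =
  \sum_(l < n) (\prod_(m < n | (m < l)%N) a m) * (a l - b l) *
         \prod_(m < n | (l < m)%N) b m.
Proof.
elim: n a b => [|n IH] a b; first by rewrite !big_ord0 subrr.
rewrite !big_ord_recl /= -[RHS]addrC.
pose A := \prod_(l < n) a (lift ord0 l); pose B := \prod_(l < n) b (lift ord0 l).
rewrite -/A -/B (_ : _ - _ = a ord0 * (A - B) + (a ord0 - b ord0) * B); last first.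
  by ring.
have below (l : 'I_n) : \prod_(m < n.+1 | (m < lift ord0 l)%N) a m
    = a ord0 * \prod_(m < n | (m < l)%N) a (lift ord0 m).
  by rewrite big_mkcond big_ord_recl [in RHS]big_mkcond.
have above (l : 'I_n) : \prod_(m < n.+1 | (lift ord0 l < m)%N) b m
    = \prod_(m < n | (l < m)%N) b (lift ord0 m).
  by rewrite big_mkcond big_ord_recl [in RHS]big_mkcond /= mul1r.
congr (_ + _).
  rewrite /A /B IH mulr_sumr; apply: eq_bigr => l _.
  by rewrite below above !mulrA.
rewrite [X in _ = X * _ * _]big_pred0 // mul1r; congr (_ * _).
by rewrite [RHS]big_mkcond big_ord_recl /= mul1r.
Qed.

Section ReferenceCell.
Context {R : realType} {n : nat}.
Implicit Types (x y : 'cV[R]_n) (k : cell_kind).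

(* The coefficients of a factorisation
   [ref_shape v y - ref_shape v x = \sum_l ref_slope v x y l * (y_l - x_l)],
   continuous in (x, y); on the diagonal they are the partial derivatives. *)
Definition ref_slope k : ref_vertex k n -> 'cV[R]_n -> 'cV[R]_n -> 'I_n -> R :=
  match k with
  | Simplex => fun v x y l =>
      if unlift ord0 v is Some m then (l == m)%:R else -1
  | Cube => fun v x y l =>
      (\prod_(m < n | (m < l)%N) (if v m then y m 0 else 1 - y m 0))
      * (if v l then 1 else -1)
      * \prod_(m < n | (l < m)%N) (if v m then x m 0 else 1 - x m 0)
  end.
Arguments ref_slope : clear implicits.

Lemma ref_shapeB k (v : ref_vertex k n) x y :
  ref_shape v y - ref_shape v x
  = \sum_l ref_slope k v x y l * (y l 0 - x l 0).
Proof.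
case: k v => /= v.
  case: unliftP => [m _|_].
    rewrite (bigD1 m) //= eqxx mul1r big1 ?addr0 // => l lm.
    by rewrite (negbTE lm) mul0r.
  rewrite -mulr_sumr sumrB mulN1r; ring.
rewrite prodrB_telescope; apply: eq_bigr => l _.
rewrite -!mulrA; congr (_ * _); rewrite mulrCA mulrC; congr (_ * _).
rewrite [in RHS]mulrC.
by case: (v l); ring.
Qed.

Lemma cube_factor_itv01 (b : bool) (t : R) :
  0 <= t <= 1 -> 0 <= (if b then t else 1 - t) <= 1.
Proof. by case: b => // /andP[t0 t1]; rewrite subr_ge0 t1 gerBl t0. Qed.

Lemma ler_ref_slope1 k (v : ref_vertex k n) x y l :
  ref_cell k x -> ref_cell k y -> `|ref_slope k v x y l| <= 1.
Proof.
case: k v => /= v cx cy.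
  by case: unliftP => [m _|_]; rewrite ?normrN ?normr1 // normr_nat lern1 leq_b1.
rewrite !normrM (_ : `|if v l then _ else _| = 1); last first.
  by case: (v l); rewrite ?normrN normr1.
rewrite mulr1 !normr_prod mulr_ile1 ?prodr_ge0 //.
  apply: prodr_ile1 => m _; rewrite normr_ge0 /=.
  by have /andP[h0 h1] := cube_factor_itv01 (v m) (cy m); rewrite ger0_norm.
apply: prodr_ile1 => m _; rewrite normr_ge0 /=.
by have /andP[h0 h1] := cube_factor_itv01 (v m) (cx m); rewrite ger0_norm.
Qed.

Lemma cvg_ref_slope k (v : ref_vertex k n) l (T : Type) (F : set_system T)
    (FF : Filter F) (u w : T -> 'cV[R]_n) x y :
  (forall m, u t m 0 @[t --> F] --> x m 0) ->
  (forall m, w t m 0 @[t --> F] --> y m 0) ->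
  ref_slope k v (u t) (w t) l @[t --> F] --> ref_slope k v x y l.
Proof.
move=> ux wy; case: k v => /= v; first by case: unliftP => *; exact: cvg_cst.
have fcvg (p : T -> 'cV[R]_n) (z : 'cV[R]_n) m :
    p t m 0 @[t --> F] --> z m 0 ->
    (if v m then p t m 0 else 1 - p t m 0) @[t --> F]
      --> (if v m then z m 0 else 1 - z m 0).
  by case: (v m) => // pz; apply: cvgB => //; exact: cvg_cst.
apply: cvgM; first apply: cvgM.
- by apply: cvg_big => [|m _]; [exact: mul_continuous|exact: fcvg].
- exact: cvg_cst.
- by apply: cvg_big => [|m _]; [exact: mul_continuous|exact: fcvg].
Qed.

Lemma cvg_ref_shape k (v : ref_vertex k n) (T : Type) (F : set_system T)
    (FF : Filter F) (u : T -> 'cV[R]_n) x :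
  (forall m, u t m 0 @[t --> F] --> x m 0) ->
  ref_shape v (u t) @[t --> F] --> ref_shape v x.
Proof.
move=> ux; case: k v => /= v.
  case: unliftP => [m _|_]; first exact: ux.
  apply: cvgB; first exact: cvg_cst.
  by apply: cvg_big => [|m _]; [exact: add_continuous|exact: ux].
apply: cvg_big => [|m _]; first exact: mul_continuous.
by case: (v m); [exact: ux|apply: cvgB; [exact: cvg_cst|exact: ux]].
Qed.

Lemma ref_shape_ge0 k (v : ref_vertex k n) x : ref_cell k x -> 0 <= ref_shape v x.
Proof.
case: k v => /= v cx.
  case: cx => x0 x1; case: unliftP => [m _|_]; first exact: x0.
  by rewrite subr_ge0.
by apply: prodr_ge0 => l _; have /andP[] := cube_factor_itv01 (v l) (cx l).
Qed.

Lemma ref_shape_sum k x : \sum_v @ref_shape R k n v x = 1.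
Proof.
case: k => /=.
  rewrite big_ord_recl unlift_none [X in _ + X](eq_bigr (fun l => x l 0)) ?subrK //.
  by move=> l _; rewrite liftK.
(* Read backwards, distributivity makes the sum over all vertices of the cube a product of the
   factors [x_l + (1 - x_l)]. *)
rewrite -(bigA_distr_bigA (fun l (b : bool) => if b then x l 0 else 1 - x l 0)) /=.
by rewrite big1 // => l _; rewrite big_bool /= addrC subrK.
Qed.

Definition ref_point k : ref_vertex k n -> 'cV[R]_n :=
  match k with
  | Simplex => fun v => \col_l (unlift ord0 v == Some l)%:R
  | Cube => fun v => \col_l (v l)%:R
  end.
Arguments ref_point : clear implicits.

Lemma ref_cell_point k v : ref_cell k (ref_point k v).
Proof.
case: k v => /= v; last by move=> l; rewrite mxE ler0n lern1 leq_b1.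
split=> [l|]; first by rewrite mxE ler0n.
case: (unliftP ord0 v) => [m _|_].
  rewrite (bigD1 m) //= mxE eqxx big1 ?addr0 // => l lm.
  by rewrite mxE (inj_eq Some_inj) eq_sym (negbTE lm).
by rewrite big1 ?ler01 // => l _; rewrite mxE.
Qed.

Lemma ref_shape_point k (v w : ref_vertex k n) :
  ref_shape w (ref_point k v) = (w == v)%:R.
Proof.
case: k v w => /= v w.
  case: (unliftP ord0 w) => [m ->|->].
    case: (unliftP ord0 v) => [l ->|->]; rewrite mxE /=.
      by rewrite (inj_eq Some_inj) (inj_eq lift_inj) eq_sym.
    by [].
  case: (unliftP ord0 v) => [l ->|->].
    rewrite (negbTE (neq_lift _ _)) (bigD1 l) //= mxE eqxx big1 ?addr0 ?subrr //.
    by move=> m ml; rewrite mxE (inj_eq Some_inj) eq_sym (negbTE ml).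
  by rewrite eqxx big1 ?subr0 // => l _; rewrite mxE.
have [->|/eqP wv] := eqVneq w v.
  by rewrite big1 // => l _; rewrite mxE; case: (v l); rewrite ?subr0.
(* Distinct vertices of the cube differ in some coordinate [l], and the factor of that coordinate is
   zero. *)
have [l /eqP wl] : exists l, w l <> v l.
  by apply/existsNP => wE; apply: wv; apply/ffunP.
rewrite (bigD1 l) //= mxE; case: (w l) (v l) wl => [] [] //= _.
  by rewrite mul0r.
by rewrite subrr mul0r.
Qed.

Lemma ref_cell_convex k x y (s : R) :
  0 <= s <= 1 -> ref_cell k x -> ref_cell k y ->
  ref_cell k ((1 - s) *: x + s *: y).
Proof.
move=> /andP[s0 s1]; have s1' : 0 <= 1 - s by rewrite subr_ge0.
case: k => /=.
  move=> [x0 x1] [y0 y1]; split=> [l|].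
    by rewrite !mxE addr_ge0 ?mulr_ge0.
  under eq_bigr do rewrite !mxE.
  rewrite big_split /= -!mulr_sumr -[leRHS](subrK s).
  by rewrite lerD // ler_piMr.
move=> cx cy l; have /andP[x0 x1] := cx l; have /andP[y0 y1] := cy l.
rewrite !mxE addr_ge0 ?mulr_ge0 //= -[leRHS](subrK s).
by rewrite lerD // ler_piMr.
Qed.

(** Provides, for both kinds of cell at once, a box with interior points; [cell_slope_unit] moves in
    arbitrary directions inside it. *)
Lemma ref_cell_box k x : (forall l, 0 <= x l 0 <= n.+1%:R^-1) -> ref_cell k x.
Proof.
have n1 : n.+1%:R^-1 <= 1 :> R by rewrite invf_le1 ?ltr0n // ler1n.
move=> xn; case: k => /=; last first.
  by move=> l; have /andP[-> x1] := xn l; rewrite (le_trans x1).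
split=> [l|]; first by have /andP[] := xn l.
apply: (@le_trans _ _ (\sum_(l < n) n.+1%:R^-1)).
  by apply: ler_sum => l _; have /andP[] := xn l.
rewrite sumr_const card_ord -[leLHS]mulr_natl ler_pdivrMr ?ltr0n // mul1r.
by rewrite ler_nat.
Qed.

Lemma compact_ref_cell k : compact (@ref_cell R k n).
Proof.
have cube : compact [set x : 'cV[R]_n | forall l, 0 <= x l 0 <= 1].
  (* Compactness of a product of segments is taken for row vectors and transported by
     transposition. *)
  have := @rV_compact R n (fun=> `[0, 1]%classic) (fun=> @segment_compact _ _ _).
  move/(continuous_compact (f := fun v : 'rV[R]_n => v^T)) => c.
  rewrite (_ : mkset _ = [set v^T | v in [set v : 'rV[R]_n |
    forall i, `[(0 : R), 1]%classic (v ord0 i)]]); last first.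
    apply/seteqP; split=> [x x01|_ [v v01 <-] l].
      by exists x^T => [l|]; rewrite ?trmxK //= mxE in_itv /= x01.
    by have := v01 l; rewrite /= in_itv /= mxE.
  apply: c; apply: continuous_subspaceT => v.
  apply: (@cvg_mx _ _ _ _ _ (nbhs_filter v)) => i j.
  rewrite mxE; under eq_fun do rewrite mxE.
  exact: coord_continuous.
case: k; last exact: cube.
(* The simplex is cut out of the compact cube by one closed condition. *)
have -> : @ref_cell R Simplex n
  = [set x : 'cV[R]_n | forall l, 0 <= x l 0 <= 1] `&`
    (fun x : 'cV[R]_n => \sum_l x l 0) @^-1` [set t | t <= 1].
  apply/seteqP; split=> [x [x0 x1]|x [/= x01 x1]]; split=> //= l.
    rewrite x0 (le_trans _ x1) // (bigD1 l) //= lerDl.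
    by apply: sumr_ge0 => m _; exact: x0.
  by have /andP[] := x01 l.
apply: compact_closedI => //; apply: preimage_closed; last exact: closed_le.
move=> x _; apply: (@cvg_big _ _ _ _ _ _ _ (nbhs x)) => [|l _].
  exact: add_continuous.
exact: coord_continuous.
Qed.

End ReferenceCell.

(** * Mesh cells *)

Section Interpolation.
Context {R : realType} {n : nat} {k : cell_kind}.
Implicit Types (a : ref_vertex k n -> R) (x y : 'cV[R]_n).

(** For [y = x] this row is the gradient of the interpolant with vertex values [a]; likewise
    [cell_slope K x x] is the Jacobian matrix of the cell map. *)
Definition interp_slope a x y : 'rV[R]_n :=
  \row_l \sum_v a v * ref_slope v x y l.

Lemma interpB a x y :
  \sum_v a v * ref_shape v y - \sum_v a v * ref_shape v x
  = (interp_slope a x y *m (y - x)) 0 0.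
Proof.
rewrite mxE -sumrB.
under eq_bigr do rewrite -mulrBr ref_shapeB mulr_sumr.
rewrite exchange_big; apply: eq_bigr => l _.
by rewrite !mxE mulr_suml; apply: eq_bigr => v _; rewrite mulrA.
Qed.

Lemma ler_interp_slope a x y l : ref_cell k x -> ref_cell k y ->
  `|interp_slope a x y 0 l| <= \sum_v `|a v|.
Proof.
move=> cx cy; rewrite mxE; apply: le_trans (ler_norm_sum _ _ _) _.
by apply: ler_sum => v _; rewrite normrM ler_piMr // ler_ref_slope1.
Qed.

Lemma cvg_interp_slope a l (T : Type) (F : set_system T)
    (FF : Filter F) (u w : T -> 'cV[R]_n) x y :
  (forall m, u t m 0 @[t --> F] --> x m 0) ->
  (forall m, w t m 0 @[t --> F] --> y m 0) ->
  interp_slope a (u t) (w t) 0 l @[t --> F] --> interp_slope a x y 0 l.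
Proof.
move=> ux wy; rewrite mxE; under eq_fun do rewrite mxE.
apply: cvg_big => [|v _]; first exact: add_continuous.
by apply: cvgM; [exact: cvg_cst|exact: cvg_ref_slope].
Qed.

End Interpolation.

Section Cells.
Context {R : realType} {n : nat} {V C : finType} {k : cell_kind}.
Variables (node : V -> 'cV[R]_n) (vert : C -> ref_vertex k n -> V).
Implicit Types (x y : 'cV[R]_n) (K : C).

Definition cell_slope K x y : 'M[R]_n :=
  \matrix_(i, j) interp_slope (fun v => node (vert K v) i 0) x y 0 j.

Lemma cell_map_coord K x i :
  cell_map node vert K x i 0 = \sum_v node (vert K v) i 0 * ref_shape v x.
Proof.
by rewrite /cell_map summxE; apply: eq_bigr => v _; rewrite mxE mulrC.
Qed.

Lemma cell_mapB K x y : cell_map node vert K y - cell_map node vert K x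
  = cell_slope K x y *m (y - x).
Proof.
apply/colP => i; rewrite [LHS]mxE [X in _ + X]mxE !cell_map_coord interpB !mxE.
by apply: eq_bigr => j _; rewrite [in RHS]mxE.
Qed.

Lemma cell_map_point K v :
  cell_map node vert K (ref_point v) = node (vert K v).
Proof.
rewrite /cell_map (bigD1 v) //= ref_shape_point eqxx scale1r.
rewrite big1 ?addr0 // => w wv.
by rewrite ref_shape_point (negbTE wv) scale0r.
Qed.

Lemma closed_cell K : closed (cell node vert K).
Proof.
apply: compact_closed; first exact: norm_hausdorff.
apply: continuous_compact; last exact: compact_ref_cell.
apply: continuous_subspaceT => x.
apply: (@cvg_mx _ _ _ _ _ (nbhs_filter x)) => i j; rewrite ord1.
rewrite cell_map_coord; under eq_fun do rewrite cell_map_coord.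
have Gx m : z m 0 @[z --> nbhs x] --> x m 0 by exact: coord_continuous.
move: (nbhs x) (nbhs_filter x : Filter (nbhs x)) Gx => G FG Gx.
apply: cvg_big => [|v _]; first exact: add_continuous.
by apply: cvgM; [exact: cvg_cst|apply: (@cvg_ref_shape _ _ _ _ _ G _ id)].
Qed.

Variables (K : C) (L : R).
Hypothesis cell_lip : forall x y, ref_cell k x -> ref_cell k y ->
  enorm (x - y) <= L * enorm (cell_map node vert K x - cell_map node vert K y).

(* At a boundary point x the Lipschitz bound is only available on a cone of
   directions; a segment from x to the inside of the reference cell yields
   pairs (z s, z s + s r h) with an arbitrary direction h, and s tends to 0. *)
Lemma cell_slope_unit x : ref_cell k x -> cell_slope K x x \in unitmx.
Proof.
move=> cx; rewrite -unitmx_tr -row_free_unit; apply: inj_row_free => v vA.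
suff h0 : v^T = 0 by rewrite -[v]trmxK h0 linear0.
have {vA} : cell_slope K x x *m v^T = 0 by rewrite -[LHS]trmxK trmx_mul trmxK vA linear0.
move: v^T => {v} h Ah; apply: enorm0_eq0.
(* [c] is the centre of the box of [ref_cell_box], and [r] is chosen so that [|r h_l| <= c0], which
   keeps [c + r h] in the box. *)
pose c0 : R := n.+1%:R^-1 / 2; pose c : 'cV[R]_n := const_mx c0.
have c0_gt0 : 0 < c0 by rewrite divr_gt0 // invr_gt0 ltr0n.
have c0E : n.+1%:R^-1 = c0 + c0 by rewrite /c0 -splitr.
pose r := c0 / (1 + enorm h).
have h1 : 0 < 1 + enorm h by rewrite ltr_pwDl // sqrtr_ge0.
have r0 : 0 < r by rewrite divr_gt0.
have cc : ref_cell k c.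
  by apply: ref_cell_box => l; rewrite mxE c0E lerDl (ltW c0_gt0).
have cch : ref_cell k (c + r *: h).
  apply: ref_cell_box => l; rewrite !mxE c0E.
  have : `|r * h l 0| <= c0.
    rewrite normrM gtr0_norm // /r mulrAC ler_pdivrMr // ler_pM2l //.
    by apply: le_trans (ler_coord_enorm h l) _; rewrite lerDr.
  by rewrite ler_norml => /andP[h2 h3]; rewrite lerD2l h3 -lerBlDl sub0r h2.
pose z (s : R) := (1 - s) *: x + s *: c.
pose w (s : R) := (1 - s) *: x + s *: (c + r *: h).
have zw s : w s - z s = (s * r) *: h.
  by apply/colP => l; rewrite !mxE; ring.
(* The Lipschitz bound for the pair [z s], [w s], divided by the positive factor [s r]. *)
have bound s : 0 < s <= 1 ->
    enorm h <= L * enorm (cell_slope K (z s) (w s) *m h).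
  move=> /andP[s0 s1]; have s01 : 0 <= s <= 1 by rewrite ltW.
  have := cell_lip (ref_cell_convex s01 cx cch) (ref_cell_convex s01 cx cc).
  rewrite -/(z s) -/(w s) cell_mapB zw -scalemxAr !enormZ.
  have sr : 0 < `|s * r| by rewrite normr_gt0 gt_eqF // mulr_gt0.
  by rewrite [L * (_ * _)]mulrCA (ler_pM2l sr).
have line (p : 'cV[R]_n) m :
    ((1 - s) *: x + s *: p) m 0 @[s --> (0 : R)^'+] --> x m 0.
  apply: cvg_at_right_filter; under eq_fun do rewrite !mxE.
  have : (1 - s) * x m 0 + s * p m 0 @[s --> (0 : R)]
      --> (1 - 0) * x m 0 + 0 * p m 0.
    apply: cvgD; apply: cvgM; try exact: cvg_cst; last exact: cvg_id.
    by apply: cvgB; [exact: cvg_cst|exact: cvg_id].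
  by rewrite subr0 mul1r mul0r addr0.
(* As [s] decreases to 0, both points tend to x and the right-hand side of [bound] tends to
   [L * enorm (A(x, x) h) = 0]. *)
have : L * enorm (cell_slope K (z s) (w s) *m h) @[s --> (0 : R)^'+]
    --> L * enorm (cell_slope K x x *m h).
  apply: cvgM; first exact: cvg_cst.
  apply: cvg_enorm => i; rewrite mxE; under eq_fun do rewrite mxE.
  apply: cvg_big => [|j _]; first exact: add_continuous.
  apply: cvgM; last exact: cvg_cst.
  rewrite mxE; under eq_fun do rewrite mxE.
  by apply: cvg_interp_slope => m; exact: line.
rewrite Ah enorm0 mulr0.
move/cvgr_to_ge; apply; near=> s; apply: bound; apply/andP; split.
  by near: s; exact: nbhs_right_gt.
by near: s; exact: nbhs_right_le.
Unshelve. all: by end_near. Qed.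

(** The cell map serves as chart. Only the image point has to be interior to the cell: its preimage
    may lie on the boundary of the reference cell. The bound does not depend on [y]. *)
Lemma derivable_cell (f : 'cV[R]_n -> R) (a : ref_vertex k n -> R) e y :
  (forall x, ref_cell k x ->
     f (cell_map node vert K x) = \sum_v a v * ref_shape v x) ->
  (cell node vert K)° y ->
  derivable f y e /\
  `|'D_e f y| <= n%:R * ((\sum_v `|a v|) * (L * enorm e)).
Proof.
move=> fa cy; have [x cx xy] := interior_subset cy.
rewrite -xy in cy *.
apply: (@derivable_chart _ _ f _ (@ref_cell R k n) x e L _
  (cell_slope K x) (interp_slope a x)) => //.
- by move=> z _; exact: cell_mapB.
- by move=> z cz; rewrite !fa // interpB.
- by move=> z cz; exact: cell_lip.
- move=> i j; rewrite mxE; under eq_fun do rewrite mxE.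
  by apply: (@cvg_interp_slope _ _ _ _ _ _ (nbhs x)) => m;
    [exact: cvg_cst|exact: coord_continuous].
- move=> j.
  by apply: (@cvg_interp_slope _ _ _ _ _ _ (nbhs x)) => m;
    [exact: cvg_cst|exact: coord_continuous].
- by move=> z j cz; exact: ler_interp_slope.
- exact: cell_slope_unit.
Qed.

End Cells.

(** * Integration and Lebesgue measure *)

Section IntegralOutsideNullSets.
Import HBNNSimple.
Context {disp : measure_display} {T : measurableType disp} {R : realType}.
Variable mu : {measure set T -> \bar R}.

(** The integral of a nonnegative function is a supremum over simple functions below it, and cutting
    a simple function off on a null set keeps its integral. No regularity of f on [N] enters, which
    suits derivatives of nodal functions on the mesh skeleton. *)
Lemma ge0_integral_setD_null (D N : set T) (f : T -> \bar R) :
  measurable D -> measurable N -> mu N = 0%E ->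
  (forall x, D x -> (0 <= f x)%E) ->
  (\int[mu]_(x in D) f x = \int[mu]_(x in D `\` N) f x)%E.
Proof.
move=> mD mN N0 f0; have mDN := measurableD mD mN.
have f0' x : (D `\` N) x -> (0 <= f x)%E by move=> [/f0].
apply/eqP; rewrite eq_le; apply/andP; split.
  rewrite (ge0_integralE _ f0); apply: ge_ereal_sup => _ [h /= hf <-].
  have mC : measurable (~` N) by exact: measurableC.
  (* [proj_nnsfun h mC] is h set to zero on [N]. *)
  have -> : sintegral mu h = sintegral mu (proj_nnsfun h mC).
    rewrite -mrestrict -integral_nnsfun //.
    have -> : sintegral mu h = sintegral mu (h \_ setT) by rewrite patch_setT.
    rewrite -integral_nnsfun // -setTD.
    apply: ge0_negligible_integral => //.
    - by apply/measurable_EFinP; exact: measurable_funTS.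
    - by move=> x _; rewrite lee_fin fun_ge0.
  rewrite (ge0_integralE _ f0'); apply: ereal_sup_ubound.
  exists (proj_nnsfun h mC) => // x.
  rewrite -(congr1 (fun g => g x) (mrestrict h mC)) !patchE in_setC in_setD.
  have := hf x; rewrite patchE.
  by case: (x \in D); case: (x \in N).
(* Conversely, a simple function below f on [D] minus [N] and below 0 elsewhere is also below f on
   [D]. *)
rewrite (ge0_integralE _ f0) (ge0_integralE _ f0').
apply: ereal_sup_le => _ [h /= hf <-]; exists h => //= x.
apply: le_trans (hf x) _; rewrite !patchE in_setD.
have [/set_mem xD|] := boolP (x \in D) => //=.
by case: (x \in N) => //=; exact: f0.
Qed.

(* Unlike [negligible_integral], f need not be measurable. *)
Lemma integral_setD_null (D N : set T) (f : T -> \bar R) :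
  measurable D -> measurable N -> mu N = 0%E ->
  (\int[mu]_(x in D) f x = \int[mu]_(x in D `\` N) f x)%E.
Proof.
move=> mD mN N0; rewrite integralE [RHS]integralE.
by congr (_ - _)%E; apply: ge0_integral_setD_null => // x _;
  rewrite ?funepos_ge0 ?funeneg_ge0.
Qed.

End IntegralOutsideNullSets.

(** * Borel measurability of continuous functions and directional derivatives *)

Section Borel.
Context {R : realType} {n : nat}.
Implicit Types (D E : set 'cV[R]_n) (f : 'cV[R]_n -> R).

Lemma open_measurable_borel D : open D -> measurable (D : set (borel R n)).
Proof. by move=> oD; exact: sub_sigma_algebra. Qed.

Lemma closed_measurable_borel D : closed D -> measurable (D : set (borel R n)).
Proof.
move=> cD; rewrite -[D]setCK; apply: measurableC.
by apply: open_measurable_borel; exact: closed_openC.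
Qed.

Lemma continuous_measurable_borel D f :
  open D -> {in D, continuous f} -> measurable_fun (D : set (borel R n)) f.
Proof.
move=> oD /(continuous_inP f oD) cf.
apply: (measurability _ (RGenOpens.measurableE R)).
move=> _ [_ [a [b ->]] <-]; apply: open_measurable_borel.
by apply: cf; exact: interval_open.
Qed.

(** The derivative is the pointwise limit of the difference quotients with steps [1 / (m + 1)]. *)
Lemma measurable_derive E f e :
  open E -> {in E, continuous f} -> (forall x, E x -> derivable f x e) ->
  measurable_fun (E : set (borel R n)) (fun x : borel R n => 'D_e f x).
Proof.
move=> oE cf df.
have mE : measurable (E : set (borel R n)) by exact: open_measurable_borel.
(* The translate of f is extended by zero, so that each quotient is defined and measurable on all of
   [E]; since [E] is open, the extension is invisible at a given point for large [m]. *)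
pose g (c x : 'cV[R]_n) : R := (f \o shift c) \_ (shift c @^-1` E) x.
have mg c : measurable_fun (setT : set (borel R n)) (g c : borel R n -> R).
  have cs : continuous (shift c : 'cV[R]_n -> 'cV[R]_n).
    move=> x; apply: (@cvgD _ _ _ (nbhs x) _ id (cst c)); first exact: cvg_id.
    exact: cvg_cst.
  have oEc : open (shift c @^-1` E) by exact: (continuousP _).1.
  apply: (measurable_restrict (f \o shift c : borel R n -> R) _ _).1 => //.
    exact: open_measurable_borel.
  rewrite setTI; apply: continuous_measurable_borel => // x /set_mem Ex.
  apply: continuous_comp; first exact: cs.
  by apply: cf; rewrite inE.
pose q (m : nat) (x : borel R n) : R := m.+1%:R * (g (m.+1%:R^-1 *: e) x - f x).
apply: (@measurable_fun_cvg _ _ _ _ q) => [m|x Ex].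
  apply: measurable_funM; first exact: measurable_cst.
  apply: measurable_funB; first exact: measurable_funTS.
  exact: continuous_measurable_borel.
have /= := df x Ex; rewrite /derivable => /cvg_ex [l fl].
have fl' : h^-1 *: ((f \o shift x) (h *: e) - f x) @[h --> (0 : R)^'] --> (l : R).
  exact: fl.
rewrite /derive (cvg_lim _ fl') //.
have harm : (forall m, harmonic m != 0 :> R) /\ harmonic m @[m --> \oo] --> (0 : R).
  by split=> [m|]; [rewrite /harmonic /= invr_eq0 pnatr_eq0|exact: cvg_harmonic].
apply: cvg_trans ((cvgr_dnbhsP _ _ _).1 fl' harmonic harm).
apply: near_eq_cvg.
have ex_cvg : (harmonic m *: e + x) @[m --> \oo] --> x.
  have /cvgD : harmonic m *: e @[m --> \oo] --> (0 : R) *: e.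
    exact: (cvgZr_tmp cvg_harmonic).
  by move=> /(_ _ _ (cvg_cst x)); rewrite scale0r add0r.
have nE : \forall m \near \oo, E (harmonic m *: e + x).
  by apply: ex_cvg; exact: open_nbhs_nbhs.
apply: filterS nE => m Em; rewrite /q /g patchE mem_set.
  by rewrite /harmonic /= invrK [x + _]addrC.
by rewrite /preimage /= addrC.
Qed.

End Borel.

(** * Lebesgue measure of open and of bounded sets *)

Section LebesgueMeasure.
Context {R : realType} {n : nat}.
Variable mu : {measure set (borel R n) -> \bar R}.
Hypothesis leb_mu : is_lebesgue mu.

Lemma measurable_box (a b : 'cV[R]_n) :
  measurable ([set x : 'cV[R]_n | forall k, a k 0 <= x k 0 <= b k 0]
              : set (borel R n)).
Proof.
apply: closed_measurable_borel.
have -> : [set x : 'cV[R]_n | forall k, a k 0 <= x k 0 <= b k 0] =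
  \bigcap_(k in setT) (fun x : 'cV[R]_n => x k 0) @^-1` `[a k 0, b k 0].
  apply/seteqP; split=> [x ax k _|x ax k]; rewrite /= ?in_itv //=.
  by have := ax k I; rewrite /= in_itv.
apply: closed_bigI => k _; apply: preimage_closed; last exact: interval_closed.
by move=> x _; exact: coord_continuous.
Qed.

Lemma lebesgue_open_gt0 (D : set 'cV[R]_n) :
  open D -> D !=set0 -> (0 < mu (D : set (borel R n)))%E.
Proof.
move=> oD [x Dx].
have /nbhs_ballP[r /= r0 rD] : nbhs x D by exact: open_nbhs_nbhs.
(* Half-width [r / 2] keeps the closed box inside the open sup-norm ball of radius [r]. *)
pose a : 'cV[R]_n := x - const_mx (r / 2).
pose b : 'cV[R]_n := x + const_mx (r / 2).
have ba k : b k 0 - a k 0 = r by rewrite !mxE; field.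
have ab k : a k 0 <= b k 0 by rewrite -subr_ge0 ba ltW.
pose B : set (borel R n) := [set z : 'cV[R]_n | forall k, a k 0 <= z k 0 <= b k 0].
have BD : B `<=` D.
  move=> z Bz; apply: rD; split=> // i j; rewrite ord1 /ball /= ltr_distlC.
  have := Bz i; rewrite !mxE => /andP[z1 z2].
  have r2 : r / 2 < r by rewrite ltr_pdivrMr // ltr_pMr // ltr1n.
  rewrite (lt_le_trans _ z1) ?(le_lt_trans z2) //.
    by rewrite ltrD2l.
  by rewrite ltrD2l ltrN2.
apply: (@lt_le_trans _ _ (mu B)).
  rewrite /B leb_mu // lte_fin; apply: prodr_gt0 => k _.
  by rewrite ba.
by apply: le_measure => //; rewrite inE;
  [exact: measurable_box|exact: open_measurable_borel].
Qed.

Lemma lebesgue_bounded_lty (D : set 'cV[R]_n) :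
  bounded_set D -> measurable (D : set (borel R n)) ->
  (mu (D : set (borel R n)) < +oo)%E.
Proof.
(* [bounded_set] gives a bound by every number above [M0]; [M] is one, and it is nonnegative, which
   orders the corners of the box. *)
move=> [M0 [_ bD]] mD; pose M := `|M0| + 1.
have M0M : M0 < M by rewrite /M ltr_pwDr // ler_norm.
have DM x k : D x -> `|x k 0| <= M.
  move=> Dx; apply: le_trans (bD _ M0M x Dx).
  rewrite [leRHS]/Num.norm /= mx_normrE; apply/bigmax_geP; right => /=.
  by exists (k, 0).
pose a : 'cV[R]_n := const_mx (- M); pose b : 'cV[R]_n := const_mx M.
have ab k : a k 0 <= b k 0.
  by rewrite !mxE -subr_ge0 opprK addr_ge0 // addr_ge0.
apply: (@le_lt_trans _ _ (mu ([set z : 'cV[R]_n | forall k, a k 0 <= z k 0 <= b k 0]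
  : set (borel R n)))); last by rewrite leb_mu // ltry.
apply: le_measure; rewrite ?inE //; first exact: measurable_box.
by move=> x Dx k; rewrite !mxE -ler_norml; exact: DM.
Qed.

(** By continuity f exceeds half of [f x0] on a nonempty open set, which has positive measure. The
    bound [M] makes the integral finite, as [fine] sends infinity to 0. *)
Lemma Rintegral_continuous_gt0 (D : set 'cV[R]_n) (f : 'cV[R]_n -> R) M x0 :
  open D -> (mu (D : set (borel R n)) < +oo)%E -> {in D, continuous f} ->
  (forall x, D x -> 0 <= f x <= M) -> D x0 -> 0 < f x0 ->
  0 < Rintegral mu D f.
Proof.
move=> oD Doo cf fM Dx0 fx0; apply: fine_gt0.
have mD := open_measurable_borel oD.
have mf : measurable_fun (D : set (borel R n)) (EFin \o f).
  by apply/measurable_EFinP; exact: continuous_measurable_borel.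
have f0 x : D x -> (0 <= (f x)%:E)%E by move=> /fM /andP[]; rewrite lee_fin.
pose c := f x0 / 2; have c0 : 0 < c by rewrite divr_gt0.
pose A := D `&` f @^-1` [set t | c < t].
have oA : open A by apply: (continuous_inP f oD).1 => //; exact: open_gt.
have mA := open_measurable_borel oA.
apply/andP; split.
  apply: (@lt_le_trans _ _ (\int[mu]_(x in A) (cst c%:E) x)%E).
    rewrite integral_cst // mule_gt0 ?lte_fin //.
    apply: lebesgue_open_gt0 => //; exists x0; split=> //=.
    by rewrite /c ltr_pdivrMr // ltr_pMr // ltr1n.
  apply: (@le_trans _ _ (\int[mu]_(x in A) (f x)%:E)%E).
    apply: ge0_le_integral => //.
    - by move=> x _; rewrite lee_fin ltW.
    - by apply: measurable_funS mf => // x [].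
    - by move=> x [_ /= /ltW]; rewrite lee_fin.
  by apply: ge0_subset_integral => // x [].
apply: (@le_lt_trans _ _ (\int[mu]_(x in D) (cst M%:E) x)%E).
  apply: ge0_le_integral => //.
  by move=> x /fM /andP[_]; rewrite lee_fin.
rewrite integral_cst // lte_mul_pinfty ?lee_fin //.
by have /andP[h1 h2] := fM _ Dx0; exact: le_trans h2.
Qed.

End LebesgueMeasure.

(** * Nodal basis *)

Section LagrangeDiscretization.
Context {R : realType} {n : nat} {V C : finType} {k : cell_kind}.
Variables (h : discretization R n V) (vert : C -> ref_vertex k n -> V).
Hypothesis leb_h : is_lebesgue (leb h).
Hypothesis poly_h : polygonal_domain (dom h).
Hypothesis mesh_h : is_mesh (node h) vert (leb h) (dom h).
Hypothesis basis_h : nodal_basis (node h) vert (dom h) (phi h).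

Local Notation D := (dom h).
Local Notation F := (cell_map (node h) vert).

Lemma open_dom : open D. Proof. by have [] := poly_h. Qed.

Lemma measurable_dom : measurable (D : set (borel R n)).
Proof. exact: (open_measurable_borel open_dom). Qed.

Lemma dom_lty : (leb h (D : set (borel R n)) < +oo)%E.
Proof.
apply: (lebesgue_bounded_lty leb_h _ measurable_dom).
by case: poly_h.
Qed.

Lemma closure_dom_cell y :
  closure D y <-> exists K, exists2 x, ref_cell k x & F K x = y.
Proof.
case: mesh_h => _ _ -> _ _; split=> [[K _ [x cx xy]]|[K [x cx xy]]].
  by exists K, x.
by exists K => //; exists x.
Qed.

(** The coefficients of [phi h i] on a cell are its values at the vertices, because the shape
    functions are dual to the reference vertices. *)
Lemma phi_cell i K x : ref_cell k x ->
  phi h i (F K x) = \sum_v (i == vert K v)%:R * ref_shape v x.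
Proof.
have [[_ /(_ K) [a fa]] phi_node] := basis_h i => cx; rewrite fa //.
apply: eq_bigr => v _; congr (_ * _); rewrite -phi_node -(cell_map_point _ _ K).
rewrite fa; last exact: ref_cell_point.
rewrite (bigD1 v) //= ref_shape_point eqxx mulr1 big1 ?addr0 // => w wv.
by rewrite ref_shape_point (negbTE wv) mulr0.
Qed.

Lemma phi_ge0 i y : closure D y -> 0 <= phi h i y.
Proof.
move=> /closure_dom_cell [K [x cx <-]]; rewrite phi_cell //.
by apply: sumr_ge0 => v _; rewrite mulr_ge0 // ref_shape_ge0.
Qed.

Lemma sum_phi y : closure D y -> \sum_i phi h i y = 1.
Proof.
move=> /closure_dom_cell [K [x cx <-]].
under eq_bigr do rewrite phi_cell //.
rewrite exchange_big -[RHS](ref_shape_sum k x); apply: eq_bigr => v _.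
rewrite -mulr_suml (bigD1 (vert K v)) //= eqxx big1 ?addr0 ?mul1r // => i iv.
by rewrite (negbTE iv).
Qed.

Lemma phi_le1 i y : closure D y -> phi h i y <= 1.
Proof.
move=> Dy; rewrite -(sum_phi Dy) (bigD1 i) //= lerDl.
by apply: sumr_ge0 => j _; exact: phi_ge0.
Qed.

Lemma phi_itv01 i y : D y -> 0 <= phi h i y <= 1.
Proof.
by move=> /subset_closure Dy; rewrite phi_ge0 ?phi_le1.
Qed.

Lemma continuous_phi i : {in D, continuous (phi h i)}.
Proof.
have [[cphi _] _] := basis_h i.
rewrite -(continuous_open_subspace (phi h i) open_dom).
by apply: continuous_subspaceW cphi; exact: subset_closure.
Qed.

(** A node may lie on the boundary of the domain, so positivity of [phi h i] is transferred from the
    node to a nearby point of the open domain. *)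
Lemma mass_gt0 i : 0 < mass h i.
Proof.
have [_ /(_ i) [K [v vi]] _ _ _] := mesh_h.
have Di : closure D (node h i).
  apply/closure_dom_cell; exists K, (ref_point v); first exact: ref_cell_point.
  by rewrite cell_map_point vi.
have [[cphi _] phi_node] := basis_h i.
have [x [Dx phi_x]] : exists x, D x /\ 0 < phi h i x.
  have : \forall x \near within (closure D) (nbhs (node h i)), 0 < phi h i x.
    have /cvgr_gt : phi h i x @[x --> within (closure D) (nbhs (node h i))] --> (1 : R).
      have <- : phi h i (node h i) = 1 by rewrite phi_node eqxx.
      by move/subspace_continuousP : cphi => /(_ _ Di).
    by apply; exact: ltr01.
  move/(Di _) => [x [Dx phi_x]].
  by exists x; split=> //; apply: phi_x; exact: subset_closure.
apply: (@Rintegral_continuous_gt0 _ _ _ leb_h _ (phi h i) 1 x) => //.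
- exact: open_dom.
- exact: dom_lty.
- exact: continuous_phi.
- by move=> y; exact: phi_itv01.
Qed.

Lemma mass2_eq0_phi i j x : mass2 h i j = 0 -> D x -> phi h i x * phi h j x = 0.
Proof.
move=> m0 Dx; apply/eqP; apply/negPn/negP => pij.
have /andP[pi0 pi1] := phi_itv01 i Dx; have /andP[pj0 pj1] := phi_itv01 j Dx.
suff : 0 < mass2 h i j by rewrite m0 ltxx.
apply: (@Rintegral_continuous_gt0 _ _ _ leb_h _
  (fun y => phi h i y * phi h j y) 1 x) => //.
- exact: open_dom.
- exact: dom_lty.
- by move=> y Dy; apply: continuousM; exact: continuous_phi.
- move=> y Dy; have /andP[? ?] := phi_itv01 i Dy; have /andP[? ?] := phi_itv01 j Dy.
  by rewrite mulr_ge0 //= mulr_ile1.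
- by rewrite lt0r pij mulr_ge0.
Qed.

Lemma cvec_eq0 i j : ~~ stencil h i j -> cvec h i j = 0.
Proof.
rewrite negbK => /eqP m0; apply/colP => l; rewrite !mxE.
rewrite (@eq_Rintegral _ _ _ _ _ (cst 0)); first by rewrite /Rintegral integral0.
move=> x /set_mem Dx /=.
have [->|pi0] := eqVneq (phi h i x) 0; first by rewrite mul0r.
rewrite (@near_eq_derive _ _ _ _ (cst 0)) ?derive_cst ?mulr0 //.
(* By continuity [phi h i] is nonzero near x, and there the vanishing product forces [phi h j] to be
   zero. *)
near=> y.
have Dy : D y by near: y; apply: open_nbhs_nbhs; split=> //; exact: open_dom.
apply: (mulfI (_ : phi h i y != 0)).
  near: y; have := @continuous_phi i x; rewrite inE => /(_ Dx) /cvgr_neq0; exact.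
by rewrite mulr0 mass2_eq0_phi.
Unshelve. all: by end_near. Qed.

(* The nodal functions are only derivable away from the skeleton of the mesh. *)
Let E : set 'cV[R]_n := D `&` \bigcup_(K in setT) (cell (node h) vert K)°.

Let open_E : open E.
Proof.
apply: openI; first exact: open_dom.
by apply: bigcup_open => K _; exact: open_interior.
Qed.

Let mE : measurable (E : set (borel R n)).
Proof. exact: open_measurable_borel. Qed.

(** A point of the domain outside [E] lies in some cell but not in its interior, and the finitely
    many cell boundaries are null. *)
Lemma skeleton_null : leb h ((D `\` E) : set (borel R n)) = 0%E.
Proof.
apply/negligibleP; first by apply: measurableD => //; exact: measurable_dom.
have [_ _ clD _ cellP] := mesh_h.
pose N K : set (borel R n) := cell (node h) vert K `\` (cell (node h) vert K)°.
have Nneg K : (leb h).-negligible (N K).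
  apply/negligibleP; last by have [_] := cellP K.
  apply: measurableD; first by apply: closed_measurable_borel; exact: closed_cell.
  by apply: open_measurable_borel; exact: open_interior.
apply: (@negligibleS _ _ _ _
  (\bigcup_m (if unpickle m is Some K then N K else set0))); last first.
  apply: negligible_bigcup => m.
  by case: unpickle => [K|]; [exact: Nneg|exact: negligible_set0].
move=> x [Dx nEx]; have := subset_closure Dx; rewrite clD => -[K _ cx].
exists (pickle K) => //; rewrite pickleK; split=> // icx.
by apply: nEx; split=> //; exists K.
Qed.

Lemma phi_derivable j e : exists M, forall x, E x ->
  derivable (phi h j) x e /\ `|'D_e (phi h j) x| <= M.
Proof.
have [_ _ _ _ cellP] := mesh_h.
have phi_K K : exists M, forall x, (cell (node h) vert K)° x ->
    derivable (phi h j) x e /\ `|'D_e (phi h j) x| <= M.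
  have [[L cellL] _] := cellP K.
  have pc x : ref_cell k x -> phi h j (F K x)
    = \sum_v (j == vert K v)%:R * ref_shape v x by exact: phi_cell.
  eexists => x cx.
  exact: (derivable_cell cellL e pc cx).
have [M MP] := choice phi_K.
(* There are finitely many cells, so the sum of the bounds serves for all of them. *)
exists (\sum_K `|M K|) => x [_ [K _ cx]].
have [dx dM] := MP K x cx; split=> //; apply: le_trans dM _.
apply: le_trans (ler_norm _) _; rewrite (bigD1 K) //= lerDl.
by apply: sumr_ge0.
Qed.

Lemma integrable_phi_derive i j e :
  (leb h).-integrable (E : set (borel R n))
    (EFin \o (fun x : borel R n => phi h i x * 'D_e (phi h j) x)).
Proof.
have [M phiM] := phi_derivable j e.
have phiE l : {in E, continuous (phi h l)}.
  by move=> x /set_mem [Dx _]; apply: continuous_phi; rewrite inE.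
apply: measurable_bounded_integrable => //.
- apply: le_lt_trans dom_lty; apply: le_measure; rewrite ?inE //.
    exact: measurable_dom.
  by move=> x [].
- apply: measurable_funM; first exact: continuous_measurable_borel.
  by apply: measurable_derive => // x /phiM[].
exists M; split=> [|M' MM' x Ex] /=; first exact: num_real.
have [_ dM] := phiM x Ex; have /andP[p0 p1] := phi_itv01 i Ex.1.
rewrite normrM (le_trans _ (ltW MM')) // -[leRHS]mul1r.
by rewrite ler_pM // ger0_norm.
Qed.

Lemma sum_cvec i : \sum_j cvec h i j = 0.
Proof.
apply/colP => l; rewrite summxE [RHS]mxE.
pose e : 'cV[R]_n := delta_mx l 0.
pose f j (x : borel R n) : R := phi h i x * 'D_e (phi h j) x.
(* The skeleton is discarded from each integral; on [E] the integrands are integrable and the sum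
   over [j] can be moved inside. *)
have cE j : cvec h i j l 0 = fine (\int[leb h]_(x in E) (f j x)%:E)%E.
  rewrite mxE /Rintegral (integral_setD_null _ measurable_dom _ skeleton_null).
    rewrite setDD setIC (_ : _ `&` _ = E) //; apply/seteqP.
    by split=> [x [] //|x Ex]; split=> //; case: Ex.
  by apply: measurableD => //; exact: measurable_dom.
under eq_bigr do rewrite cE.
rewrite sum_fine; last first.
  by move=> j _; apply: integrable_fin_num => //; exact: integrable_phi_derive.
rewrite -integral_sum //; last by move=> j; exact: integrable_phi_derive.
rewrite (eq_integral (cst 0%E)) ?integral0 // => x /set_mem Ex.
rewrite sumEFin /f -mulr_sumr.
suff -> : \sum_j 'D_e (phi h j) x = 0 by rewrite mulr0.
have dphi j : derivable (phi h j) x e.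
  by have [M phiM] := phi_derivable j e; have [] := phiM x Ex.
have : is_derive x e (\sum_j phi h j) (\sum_j 'D_e (phi h j) x).
  apply: (big_rec2 (fun g dg => is_derive x e g dg)); first exact: is_derive_cst.
  by move=> j g dg _ gP; apply: is_deriveD; apply: derivableP.
move=> sumP; rewrite -(@derive_val _ _ _ _ _ _ _ sumP).
(* In a neighbourhood of x contained in the domain, the nodal functions sum to the constant 1. *)
rewrite (@near_eq_derive _ _ _ _ (cst (1 : R))) ?derive_cst //.
have nD : nbhs x D by apply: open_nbhs_nbhs; split; [exact: open_dom|case: Ex].
by apply: filterS nD => y /subset_closure Dy; rewrite fct_sumE sum_phi.
Qed.

Lemma sum_stencil_cvec i : \sum_(j | stencil h i j) cvec h i j = 0.
Proof.
rewrite -[RHS](sum_cvec i) [RHS](bigID (stencil h i)) /=.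
by rewrite [X in _ + X]big1 ?addr0 // => j; exact: cvec_eq0.
Qed.

End LagrangeDiscretization.

Theorem lemma3p5 (R : realType) (d : nat) (V : finType)
    (P : physics R) (h : discretization R d.+1 V)
    (lam : 'cV[R]_d.+1 -> state R d.+1 -> state R d.+1 -> R)
    (U : V -> state R d.+1) (tau : R) :
  0 <= grav P -> 1 < gam P -> 0 < Ceos P ->
  lagrange_discretization h ->
  max_wave_speed_bound P lam ->
  (forall i, admissible (U i)) ->
  (forall i j, stencil h i j -> j != i -> 0 < visc P h lam U i j) ->
  0 < tau ->
  forall (i : V) (Unew : state R d.+1),
    Unew = low_update P h lam U tau i <->
    mass h i *: (tau^-1 *: (Unew - U i)) =
      \sum_(j | stencil h i j) low_flux P h lam U i j.
Proof.
move=> _ gam1 _ [leb_h poly_h [k [C [vert [mesh_h basis_h]]]]] _ admU visc_gt0.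
move=> tau_gt0 i Unew; apply: low_update_flux_form => //.
- by rewrite gt_eqF.
- by rewrite gt_eqF // (mass_gt0 leb_h poly_h mesh_h basis_h).
- exact: sum_stencil_cvec leb_h poly_h mesh_h basis_h i.
- by move=> j sij ji; rewrite gt_eqF // visc_gt0.
Qed.
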